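(* There is a universal constant $c>0$ such that the following holds. Let $d\ge1$ be an integer, let $\varepsilon\in(0,1)$, and let $G\le S_d$ be a transitive permutation group of $\{1,\ldots,d\}$ with $|G|<2^{\varepsilon d}$, acting on $\mathbb{F}_2^d$ by permuting coordinates. Then $$c_1(\mathbb{F}_2^d/G)\ \ge\ c\cdot\frac{1-\varepsilon}{1-\log(1-\varepsilon)}\cdot\log d .$$
   Context: $\mathbb{F}_2^d=\{0,1\}^d$ is equipped with the Hamming metric $\rho(x,y)=|\{j: x_j\ne y_j\}|$; coordinate permutations are isometries. $\mathbb{F}_2^d/G$ is the set of orbits $Gx$ with the quotient metric $\rho_{\mathbb{F}_2^d/G}(Gx,Gy)=\min\{\rho(u,v): u\in Gx,\ v\in Gy\}$. $\log$ is the natural logarithm. Distortion: for metric spaces $(X,d_X),(Y,d_Y)$ and $f:X\to Y$, $\|f\|_{\mathrm{Lip}}=\sup_{x\ne y} d_Y(f(x),f(y))/d_X(x,y)$. If $f$ is one-to-one, $\mathrm{dist}(f)=\|f\|_{\mathrm{Lip}}\cdot\|f^{-1}\|_{\mathrm{Lip}}$ (with $f^{-1}$ defined on $f(X)$); otherwise $\mathrm{dist}(f)=\infty$. $c_Y(X)=\inf\{\mathrm{dist}(f): f:X\to Y\}$, and $c_1(X)=c_{L_1}(X)$, where $L_1=L_1([0,1])$. *)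

(* Defs.v *)
From HB Require Import structures.
From mathcomp Require Import all_boot all_order all_algebra all_fingroup.
From mathcomp Require Import all_classical all_reals all_analysis.
From mathcomp Require Import measurable_realfun.

Set Implicit Arguments.
Unset Strict Implicit.
Unset Printing Implicit Defensive.

Import Order.TTheory GRing.Theory Num.Theory.
Import numFieldNormedType.Exports.

Local Open Scope ring_scope.

(** ** The quotient of the Hamming cube by a permutation group *)

Section Cube.
Variable d : nat.

Definition cube : Type := 'rV['F_2]_d.
HB.instance Definition _ := Finite.on cube.

Definition hamming (x y : cube) : nat := #|[pred j | x 0 j != y 0 j]|.

(* The inverse makes this a right action: the entry in position [j] of [x]
   ends up in position [s j]. *)
Definition cube_perm (x : cube) (s : 'S_d) : cube := col_perm s^-1%g x.

Fact cube_perm1 : cube_perm^~ 1%g =1 id.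
Proof. by move=> x; rewrite /cube_perm invg1 col_perm1. Qed.

Fact cube_permM (x : cube) : act_morph cube_perm x.
Proof. by move=> s t; rewrite /cube_perm invMg col_permM. Qed.

Definition cube_action := TotalAction cube_perm1 cube_permM.

Lemma hamming_perm (s : 'S_d) (x y : cube) :
  hamming (cube_perm x s) (cube_perm y s) = hamming x y.
Proof.
rewrite /hamming -!sum1_card (reindex_inj (@perm_inj _ s)) /=.
by apply: eq_bigl => j; rewrite !inE !mxE permK.
Qed.

Lemma hammingC (x y : cube) : hamming x y = hamming y x.
Proof. by apply: eq_card => j; rewrite !inE eq_sym. Qed.

Lemma hammingxx (x : cube) : hamming x x = 0%N.
Proof. by apply: eq_card0 => j; rewrite !inE eqxx. Qed.

Lemma hamming_eq0 (x y : cube) : hamming x y = 0%N -> x = y.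
Proof.
move=> /card0_eq xy; apply/rowP => j; apply/eqP.
by have := xy j; rewrite !inE => /negbFE.
Qed.

Lemma hamming_triangle (y x z : cube) :
  (hamming x z <= hamming x y + hamming y z)%N.
Proof.
have hE u v : hamming u v = (\sum_j (u 0%R j != v 0%R j))%N.
  by rewrite /hamming -sum1_card big_mkcond; apply: eq_bigr => j _; rewrite inE; case: eqP.
rewrite !hE -big_split /=; apply: leq_sum => j _.
have [->|_] := eqVneq (x 0 j) (y 0 j); first by rewrite add0n.
by apply: leq_trans (leq_b1 _) _; rewrite leq_addr.
Qed.

Lemma hamming_le (x y : cube) : (hamming x y <= d)%N.
Proof. by rewrite -[leqRHS]card_ord max_card. Qed.

(* The default value [d] of the minimum is an upper bound of [hamming], so it
   plays no role when [A] and [B] are nonempty, see [hamming_set_min]. *)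
Definition hamming_set (A B : {set cube}) : nat :=
  \big[minn/d]_(u in A) \big[minn/d]_(v in B) hamming u v.

Lemma hamming_set_le (A B : {set cube}) u v :
  u \in A -> v \in B -> (hamming_set A B <= hamming u v)%N.
Proof.
have min_le (P : pred cube) F w : P w -> (\big[minn/d]_(i | P i) F i <= F w)%N.
  by move=> Pw; rewrite -leEnat -minEnat; exact: bigmin_le_cond.
by move=> uA vB; apply: leq_trans (min_le _ _ _ uA) (min_le _ _ _ vB).
Qed.

Lemma hamming_set_min (A B : {set cube}) (a b : cube) :
  a \in A -> b \in B ->
  exists u v, [/\ u \in A, v \in B & hamming_set A B = hamming u v].
Proof.
move=> aA bB.
pose P n := (exists u v, [/\ u \in A, v \in B & n = hamming u v]) \/ n = d.
have Pmin : forall m n, P m -> P n -> P (minn m n).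
  by move=> m n Pm Pn; rewrite /minn; case: ifP.
have : P (hamming_set A B).
  apply: big_ind => //; first by right.
  move=> u uA; apply: big_ind => //; first by right.
  by move=> v vB; left; exists u, v.
case=> // ABd; exists a, b; split=> //.
by apply/eqP; rewrite eqn_leq hamming_set_le //= ABd hamming_le.
Qed.

End Cube.

(* [R] is a phantom: it is the field in which the distances of the [metricType]
   structure below take their values. *)
Definition orbit_space (R : realType) (d : nat) (G : {group 'S_d}) : Type :=
  {A : {set cube d} | A \in [set orbit (cube_action d) G x | x : cube d]%SET}.

Section OrbitSpace.
Variables (R : realType) (d : nat) (G : {group 'S_d}).
Local Notation orbit_space := (orbit_space R G).

HB.instance Definition _ := Finite.on orbit_space.

Definition orbit_dist (X Y : orbit_space) : R :=
  (hamming_set (val X) (val Y))%:R.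

Implicit Types X Y Z : orbit_space.

Lemma orbit_spaceP X x : x \in val X -> val X = orbit (cube_action d) G x.
Proof.
move: (valP X) => /imsetP[y _ ->] xy.
by apply/orbit_eqP; rewrite orbit_sym.
Qed.

Lemma orbit_space_inh X : exists x, x \in val X.
Proof.
by move: (valP X) => /imsetP[y _ ->]; exists y; rewrite orbit_refl.
Qed.

Lemma orbit_distP X Y : exists u v,
  [/\ u \in val X, v \in val Y & orbit_dist X Y = (hamming u v)%:R].
Proof.
have [[x xX] [y yY]] := (orbit_space_inh X, orbit_space_inh Y).
have [u [v [uX vY e]]] := hamming_set_min xX yY.
by exists u, v; split; rewrite /orbit_dist ?e.
Qed.

Lemma orbit_dist_le X Y u v :
  u \in val X -> v \in val Y -> orbit_dist X Y <= (hamming u v)%:R.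
Proof. by move=> uX vY; rewrite ler_nat hamming_set_le. Qed.

Fact orbit_distxx X : orbit_dist X X = 0.
Proof.
have [x xX] := orbit_space_inh X.
by apply/eqP; rewrite eq_le ler0n andbT (le_trans (orbit_dist_le xX xX)) ?hammingxx.
Qed.

Fact orbit_dist_positivity X Y : orbit_dist X Y = 0 -> X = Y.
Proof.
have [u [v [uX vY ->]]] := orbit_distP X Y.
move=> /eqP; rewrite pnatr_eq0 => /eqP/hamming_eq0 uv.
by apply: val_inj; rewrite (orbit_spaceP uX) uv (orbit_spaceP vY).
Qed.

Fact orbit_dist_sym X Y : orbit_dist X Y = orbit_dist Y X.
Proof.
suff le A B : orbit_dist A B <= orbit_dist B A by apply/eqP; rewrite eq_le !le.
have [u [v [uB vA ->]]] := orbit_distP B A.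
by rewrite hammingC orbit_dist_le.
Qed.

Fact orbit_dist_triangle Y X Z :
  orbit_dist X Z <= orbit_dist X Y + orbit_dist Y Z.
Proof.
have [u [v [uX vY ->]]] := orbit_distP X Y.
have [v' [w [v'Y wZ ->]]] := orbit_distP Y Z.
move: v'Y; rewrite (orbit_spaceP vY) => /orbitP[s sG /= v'E].
rewrite -natrD -(hamming_perm s u v).
rewrite (le_trans (orbit_dist_le (u := cube_perm u s) _ wZ)) //.
  by rewrite (orbit_spaceP uX); apply/orbitP; exists s.
by rewrite ler_nat -v'E hamming_triangle.
Qed.

HB.instance Definition _ := @isMetric.Build R orbit_space orbit_dist
  orbit_distxx orbit_dist_positivity orbit_dist_sym orbit_dist_triangle.

End OrbitSpace.

Local Open Scope classical_set_scope.

(** ** Distortion *)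

Section Distortion.
Variable R : realType.

(* The distances are explicit arguments because the domain of [f^-1] is the
   subtype [range f], which carries the restricted distance but is not
   registered as a [metricType]. The supremum is taken in [[0, +oo]], so that
   it is [0] (and not [-oo]) when the domain has at most one point. *)
Definition lip_norm (S T : Type) (dS : S -> S -> R) (dT : T -> T -> R)
    (f : S -> T) : \bar R :=
  maxe 0%E (ereal_sup
    [set (dT (f p.1) (f p.2) / dS p.1 p.2)%:E | p in [set p | p.1 <> p.2]]).

Lemma range_preimage (S T : Type) (f : S -> T) (y : range f) :
  exists x, f x = val y.
Proof. by have [x _ fx] := set_mem (valP y); exists x. Qed.

(* [f^-1], defined on [f(X)]; it is the inverse only if [f] is injective. *)
Definition range_inv (S T : Type) (f : S -> T) (y : range f) : S :=
  projT1 (cid (range_preimage y)).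

Definition distortion (X Y : metricType R) (f : X -> Y) : \bar R :=
  if `[< injective f >] then
    (lip_norm (@mdist R X) (@mdist R Y) f *
     lip_norm (fun u v : range f => mdist (val u) (val v)) (@mdist R X)
              (@range_inv X Y f))%E
  else +oo%E.

(* c_Y(X), with the target space Y first *)
Definition least_distortion (Y X : metricType R) : \bar R :=
  ereal_inf (range (@distortion X Y)).

End Distortion.

(** ** The metric space L_1([0,1]) *)

Section L1.
Variable R : realType.

(* Lebesgue measure on [[0, 1]], extended by [0] to the whole line: its L_1
   space is L_1([0,1]). *)
Definition lebesgue01 : {measure set (measurableTypeR R) -> \bar R} :=
  mrestr (@lebesgue_measure R) (measurable_itv `[0%R, 1%R]%O).

Definition L1_01 : Type := LspaceType1 lebesgue01.
HB.instance Definition _ := gen_eqMixin L1_01.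
HB.instance Definition _ := gen_choiceMixin L1_01.

Implicit Types f g h : L1_01.

Definition L1_dist f g : R :=
  fine ('N[lebesgue01]_1[EFin \o (fun x => f x - g x : R)%R])%E.


Let meas f : measurable_fun [set: measurableTypeR R] (f : _ -> R).
Proof. exact: (measurable_funPT (generic_quotient.repr (f : aeEqMfun _ _))). Qed.

Let meas_sub f g :
  measurable_fun [set: measurableTypeR R] (fun x => f x - g x : R).
Proof. exact: measurable_funB (meas f) (meas g). Qed.

Let norm_fin f : ('N[lebesgue01]_1[EFin \o f] < +oo)%E.
Proof. exact: Lebesgue_finite. Qed.

Fact L1_distE f g :
  (L1_dist f g)%:E = 'N[lebesgue01]_1[EFin \o (fun x => f x - g x : R)%R]%E.
Proof.
rewrite /L1_dist fineK// ge0_fin_numE ?Lnorm_ge0//.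
have := eminkowski lebesgue01 (meas f) (measurable_funN (meas g)) (lexx 1%E).
move=> /le_lt_trans; apply.
have -> : EFin \o (\- g)%R = (\- (EFin \o g))%E by [].
by rewrite oppe_Lnorm lte_add_pinfty.
Qed.

Fact L1_distxx f : L1_dist f f = 0.
Proof.
apply: EFin_inj; rewrite L1_distE -[RHS](@Lnorm0 _ _ _ lebesgue01 1%E)//.
by apply: eq_Lnorm => x /=; rewrite subrr.
Qed.

Fact L1_dist_sym f g : L1_dist f g = L1_dist g f.
Proof.
apply: EFin_inj; rewrite !L1_distE -oppe_Lnorm; apply: eq_Lnorm => x /=.
by congr EFin; rewrite -[RHS]opprB.
Qed.

Fact L1_dist_triangle g f h : L1_dist f h <= L1_dist f g + L1_dist g h.
Proof.
rewrite -lee_fin EFinD !L1_distE.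
have -> : EFin \o (fun x => f x - h x) =
    EFin \o ((fun x => f x - g x) \+ (fun x => g x - h x))%R.
  by apply/funext => x /=; rewrite addrA subrK.
exact: eminkowski.
Qed.

Fact L1_dist_positivity f g : L1_dist f g = 0 -> f = g.
Proof.
move=> fg0; have fg : ae_eq lebesgue01 setT f g.
  have := L1_distE f g; rewrite fg0 => /esym/Lnorm_eq0_eq0.
  have mfg : measurable_fun setT (EFin \o (fun x => f x - g x)).
    exact/measurable_EFinP.
  move=> /(_ mfg lte01); apply: filterS => x /(_ I) /= [] /eqP.
  by rewrite subr_eq0 => /eqP.
case: f g fg {fg0} => [f [[ff]]] [g [[gf]]] /= fg.
have fge : f = g.
  rewrite -[f]generic_quotient.reprK -[g]generic_quotient.reprK.
  exact/generic_quotient.eqmodP/asboolP.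
by case: _ / fge in gf fg *; rewrite (bool_irrelevance ff gf).
Qed.

HB.instance Definition _ := @isMetric.Build R L1_01 L1_dist
  L1_distxx L1_dist_positivity L1_dist_sym L1_dist_triangle.

(* c_1(X) *)
Definition L1_distortion (X : metricType R) : \bar R :=
  least_distortion L1_01 X.

End L1.

(* Main.v *)
Require Import Defs.
From mathcomp Require Import all_boot all_order all_algebra all_fingroup.
From mathcomp Require Import all_classical all_reals all_analysis.
From mathcomp Require Import measurable_realfun ring lra.

Set Implicit Arguments.
Unset Strict Implicit.
Unset Printing Implicit Defensive.

Import Order.TTheory GRing.Theory Num.Theory.
Import numFieldNormedType.Exports.

Local Open Scope ring_scope.

(** Let [f] be a [0/1]-valued function on the cube, constant on the orbits of
    [G], with variance [v]; since [G] is transitive, all its influences are equal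
    to some [a]. Decompose [f - E f] into the martingale differences [f_n] obtained
    by averaging out one coordinate after the other. The logarithmic Sobolev
    inequality for each [f_n], with [E |f_n| <= a / 2], gives
    [v ln (4 v / (d a^2)) <= d a], whence [v ln d <= 3 d a] (Falik and
    Samorodnitsky). Being linear in cut metrics, the latter is a Poincare
    inequality for every [L_1]-valued [F] on the quotient:
    [ln d * E_{x,y} |F x - F y| <= 6 sum_k E_x |F x - F (x + e_k)|].
    For [F] of Lipschitz constant [A], with inverse of Lipschitz constant [B],
    this reads [ln d * E rho <= 6 d A B]. Finally
    [E expR (- t rho) <= |G| ((1 + expR (- t)) / 2)^d] and Jensen's inequality
    bound the mean quotient distance [E rho] from below by
    [d (1 - eps) / (8 (1 - ln (1 - eps)))]. *)

(** * Means over a finite type *)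

Section Mean.
Variables (R : realType) (T : finType).
Implicit Types f g : T -> R.

Definition mean f : R := #|T|%:R^-1 * \sum_x f x.

Lemma eq_mean f g : f =1 g -> mean f = mean g.
Proof. by move=> fg; rewrite /mean (eq_bigr _ (fun x _ => fg x)). Qed.

Lemma meanD f g : mean (fun x => f x + g x) = mean f + mean g.
Proof. by rewrite /mean big_split mulrDr. Qed.

Lemma meanZ c f : mean (fun x => c * f x) = c * mean f.
Proof. by rewrite /mean -mulr_sumr mulrCA. Qed.

Lemma meanB f g : mean (fun x => f x - g x) = mean f - mean g.
Proof. by rewrite /mean sumrB mulrBr. Qed.

Lemma le_mean f g : (forall x, f x <= g x) -> mean f <= mean g.
Proof. by move=> fg; rewrite ler_wpM2l ?invr_ge0 ?ler0n// ler_sum. Qed.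

Lemma mean_ge0 f : (forall x, 0 <= f x) -> 0 <= mean f.
Proof. by move=> f0; rewrite mulr_ge0 ?invr_ge0 ?ler0n// sumr_ge0. Qed.

Lemma mean_inj (s : T -> T) f : injective s -> mean (fun x => f (s x)) = mean f.
Proof. by move=> sI; rewrite /mean [in RHS](reindex_inj sI). Qed.

Lemma mean_cst c : (0 < #|T|)%N -> mean (fun=> c) = c.
Proof.
move=> T0; rewrite /mean sumr_const -[c *+ _]mulr_natl mulrA mulVf ?mul1r//.
by rewrite pnatr_eq0 -lt0n.
Qed.

Lemma mean_variance f : (0 < #|T|)%N ->
  mean (fun x => mean (fun y => (f x - f y) ^+ 2)) =
  2 * (mean (fun x => f x ^+ 2) - mean f ^+ 2).
Proof.
move=> T0.
under eq_mean => x.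
  under eq_mean => y do rewrite sqrrB.
  rewrite meanD meanB (mean_cst _ T0).
  under [X in _ - X]eq_mean => y do rewrite -mulrnAl.
  rewrite meanZ.
over.
rewrite meanD meanB (mean_cst _ T0).
under [X in _ - X]eq_mean => x do rewrite mulrC -mulr_natr mulrCA mulrC.
by rewrite !meanZ; ring.
Qed.

(** The exponential lies above its tangent line at [mean f]. *)
Lemma mean_Jensen_expR f : (0 < #|T|)%N ->
  expR (mean f) <= mean (fun x => expR (f x)).
Proof.
move=> T0; have -> : expR (mean f) = mean (fun x => expR (mean f) * (1 + (f x - mean f))).
  by rewrite meanZ meanD meanB !mean_cst// subrr addr0 mulr1.
apply: le_mean => x.
have -> : expR (f x) = expR (mean f) * expR (f x - mean f) by rewrite -expRD subrKC.
by rewrite ler_pM2l ?expR_gt0 ?expR_ge1Dx.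
Qed.

End Mean.

(** * The function [t ln t] and a two-point entropy inequality *)

Section EntropyFunction.
Variable R : realType.
Implicit Types u v w t : R.

Definition xlnx t : R := t * ln t.

(* The tangent bound [ln t <= t - 1] at [t = u / m]. *)
Lemma xlnx_le u m : 0 <= u -> 0 < m -> xlnx u <= u * ln m + u ^+ 2 / m - u.
Proof.
rewrite /xlnx le_eqVlt => /predU1P[<-|u0] m0; first by rewrite !mul0r expr0n/= mul0r subr0 addr0.
have := @le_ln1Dx _ (u / m - 1); rewrite addrCA subrr addr0 ln_div ?posrE//.
have um : 0 < u / m by rewrite divr_gt0.
move=> /(_ ltac:(lra)) h.
have := ler_wpM2l (ltW u0) h; rewrite expr2 !mulrBr mulr1 mulrA; lra.
Qed.

(** In [xlnx_le] for [u] and for [v], take [m] to be their midpoint: the logarithms cancel and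
    [(u - v)^2 / (u + v)] remains. *)
Lemma xlnx_two_point u v w : 0 <= u -> 0 <= v -> 0 <= w ->
  (u - v) ^+ 2 <= w * (u + v) ->
  xlnx u + xlnx v - 2 * xlnx ((u + v) / 2) <= w.
Proof.
move=> u0 v0 w0 uvw.
have : 0 <= u + v by rewrite addr_ge0.
rewrite le_eqVlt => /predU1P[uv0|uv0].
  have [-> ->] : u = 0 /\ v = 0 by split; lra.
  by rewrite /xlnx addr0 !mul0r mulr0 addr0 subr0.
have m0 : 0 < (u + v) / 2 by lra.
have := xlnx_le u0 m0; have := xlnx_le v0 m0; rewrite [in xlnx (_ / _)]/xlnx.
set L := ln _ => hv hu.
suff : u ^+ 2 / ((u + v) / 2) + v ^+ 2 / ((u + v) / 2) - u - v <= w.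
  by move: hu hv; nra.
have -> : u ^+ 2 / ((u + v) / 2) + v ^+ 2 / ((u + v) / 2) - u - v =
   (u - v) ^+ 2 / (u + v) by field; rewrite gt_eqF.
by rewrite ler_pdivrMr.
Qed.

(** The cone [p^2 <= w q] is convex: the cross term satisfies [(2 p1 p2)^2 <= 4 w1 q2 w2 q1 <= (w1
    q2 + w2 q1)^2]. *)
Lemma two_point_relD p1 q1 w1 p2 q2 w2 : 0 <= q1 -> 0 <= w1 -> 0 <= q2 -> 0 <= w2 ->
  p1 ^+ 2 <= w1 * q1 -> p2 ^+ 2 <= w2 * q2 :> R ->
  (p1 + p2) ^+ 2 <= (w1 + w2) * (q1 + q2).
Proof.
move=> q10 w10 q20 w20 h1 h2.
suff : 2 * (p1 * p2) <= w1 * q2 + w2 * q1 by nra.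
apply: le_trans (ler_norm _) _.
rewrite -[leRHS]ger0_norm ?addr_ge0 ?mulr_ge0// -ler_sqr ?nnegrE//.
rewrite !real_normK ?num_real//.
have := ler_pM (sqr_ge0 _) (sqr_ge0 _) h1 h2.
have := sqr_ge0 (w1 * q2 - w2 * q1); nra.
Qed.

End EntropyFunction.

(** * Coordinate flips on the cube *)

Section Flip.
Variable d : nat.
Implicit Types x y : cube d.

(* The coordinate is a natural number, and [flip k] is the identity for
   [d <= k]: this allows iteration over [k] without ordinals. *)
Definition flip (k : nat) (x : cube d) : cube d :=
  (x : 'rV['F_2]_d) + \row_j ((j == k :> nat)%:R : 'F_2).

Lemma flipE k x j : flip k x 0 j = x 0 j + (j == k :> nat)%:R.
Proof. by rewrite !mxE. Qed.

Lemma flipK k : involutive (flip k).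
Proof.
move=> x; apply/rowP => j; rewrite !flipE -addrA.
by rewrite (addrr_pchar2 (pchar_Fp _)) ?addr0.
Qed.

Lemma flipC k l x : flip k (flip l x) = flip l (flip k x).
Proof. by apply/rowP => j; rewrite !flipE addrAC. Qed.

Lemma cube_gt0 : (0 < #|{: cube d}|)%N.
Proof. by apply/card_gt0P; exists (0 : 'rV['F_2]_d). Qed.

Lemma flip_invariant_cst (T : Type) (f : cube d -> T) :
  (forall k x, (k < d)%N -> f (flip k x) = f x) -> forall x y, f x = f y.
Proof.
move=> fi.
suff f0 x : f x = f (0 : 'rV['F_2]_d) by move=> x y; rewrite !f0.
(* [trunc k] clears the coordinates below [k]; clearing one more is either trivial or a flip. *)
pose trunc (k : nat) : cube d := \row_j (if (j < k)%N then 0 else x 0 j).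
have ft k : (k <= d)%N -> f x = f (trunc k).
  elim: k => [|k IH] kd; first by congr f; apply/rowP => j; rewrite !mxE.
  rewrite IH; last exact: ltnW.
  have [xk|xk] := eqVneq (x 0 (Ordinal kd)) 0.
    congr f; apply/rowP => j; rewrite !mxE ltnS [(j <= k)%N]leq_eqVlt.
    have [jk|//] := eqVneq (j : nat) k.
    have -> : j = Ordinal kd by apply: val_inj.
    by rewrite xk /= ltnn.
  rewrite -(fi k)//; congr f; apply/rowP => j; rewrite flipE !mxE ltnS [(j <= k)%N]leq_eqVlt.
  have [jk|_] := eqVneq (j : nat) k; last by rewrite addr0.
  have -> : j = Ordinal kd by apply: val_inj.
  rewrite /= ltnn; move: xk; case: (x 0 _) => -[|[|//]] //= i _.
  by apply: val_inj.
rewrite (ft d)//; congr f; apply/rowP => j; by rewrite !mxE ltn_ord.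
Qed.

End Flip.

(** * Martingale differences and the logarithmic Sobolev inequality *)

Section Averaging.
Variables (R : realType) (d : nat).
Implicit Types f g h : cube d -> R.

(** The conditional expectation that forgets coordinate [k]; [avgs n] forgets the coordinates below
    [n]. *)
Definition avg k f : cube d -> R := fun x => (f x + f (flip k x)) / 2.

Definition avgs n f : cube d -> R := iteri n avg f.

Definition diff k f : cube d -> R := fun x => f x - f (flip k x).

Lemma mean_flip k f : mean (fun x => f (flip k x)) = mean f.
Proof. exact: mean_inj (can_inj (@flipK d k)). Qed.

Lemma mean_avg k f : mean (avg k f) = mean f.
Proof.
rewrite /avg; under eq_mean do rewrite mulrC.
by rewrite meanZ meanD mean_flip; field.
Qed.

Lemma mean_avgs n f : mean (avgs n f) = mean f.
Proof. by elim: n => //= n IH; rewrite -IH; exact: mean_avg. Qed.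

Lemma avg_flip k f x : avg k f (flip k x) = avg k f x.
Proof. by rewrite /avg flipK addrC. Qed.

Lemma avgs_flip n k f x : (k < n)%N -> avgs n f (flip k x) = avgs n f x.
Proof.
elim: n x => //= n IH x; rewrite ltnS leq_eqVlt => /predU1P[->|kn].
  exact: avg_flip.
by rewrite /avg flipC !IH.
Qed.

Lemma avgs_full f x : avgs d f x = mean f.
Proof.
rewrite -(mean_avgs d f) -[LHS](@mean_cst R (cube d) _ (cube_gt0 d)).
by apply: eq_mean => y; apply: flip_invariant_cst => k z; exact: avgs_flip.
Qed.

Lemma avgs_ge0 n f : (forall x, 0 <= f x) -> forall x, 0 <= avgs n f x.
Proof.
by move=> f0; elim: n => //= n IH x; rewrite /avg divr_ge0 ?addr_ge0 ?IH.
Qed.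

Lemma avgsB n f g x : avgs n (fun x => f x - g x) x = avgs n f x - avgs n g x.
Proof. by elim: n x => //= n IH x; rewrite /avg !IH; field. Qed.

Lemma avgs_shift n k f x : avgs n (fun x => f (flip k x)) x = avgs n f (flip k x).
Proof. by elim: n x => //= n IH x; rewrite /avg !IH flipC. Qed.

Lemma avgs_diff n k f x : avgs n (diff k f) x = diff k (avgs n f) x.
Proof. by rewrite /diff avgsB avgs_shift. Qed.

Lemma mean_norm_avgs n f : mean (fun x => `|avgs n f x|) <= mean (fun x => `|f x|).
Proof.
elim: n => // n; apply: le_trans.
rewrite -[leRHS](mean_avg n); apply: le_mean => x /=.
by rewrite /avg normrM [`|2^-1|]gtr0_norm ?invr_gt0// ler_pM2r ?invr_gt0// ler_normD.
Qed.

(** The martingale difference produced by forgetting coordinate [n]. *)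
Definition incr n f : cube d -> R := fun x => avgs n f x - avgs n.+1 f x.

Lemma incrE n f x : incr n f x = diff n (avgs n f) x / 2.
Proof. by rewrite /incr /diff /= /avg; field. Qed.

Lemma incr_diff n k f x : incr n (diff k f) x = diff k (incr n f) x.
Proof. by rewrite /incr -!/(avgs _ _) !avgs_diff /diff; ring. Qed.

(** Parallelogram identity for the values of [avgs n f] at two points exchanged by [flip n]. *)
Lemma mean_incr_sqr n f :
  mean (fun x => incr n f x ^+ 2) =
  mean (fun x => avgs n f x ^+ 2) - mean (fun x => avgs n.+1 f x ^+ 2).
Proof.
set g := avgs n f.
have e x : avgs n f x ^+ 2 + avgs n f (flip n x) ^+ 2 =
    2 * (incr n f x ^+ 2 + avgs n.+1 f x ^+ 2).
  by rewrite /incr /= /avg; field.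
have := eq_mean e.
rewrite meanD (mean_flip n (fun x => avgs n f x ^+ 2)) meanZ meanD; lra.
Qed.

(* Orthogonality of the martingale differences of [f] along the filtration that
   forgets one coordinate at a time. *)
Lemma sum_incr_sqr f :
  \sum_(n < d) mean (fun x => incr n f x ^+ 2) =
  mean (fun x => f x ^+ 2) - mean f ^+ 2.
Proof.
under eq_bigr do rewrite mean_incr_sqr.
rewrite -(big_mkord xpredT (fun n => mean (fun x => avgs n f x ^+ 2) -
   mean (fun x => avgs n.+1 f x ^+ 2))).
rewrite -[LHS]opprK -sumrN; under eq_bigr do rewrite opprB.
rewrite telescope_sumr// opprB; congr (_ - _).
by under eq_mean do rewrite avgs_full; rewrite (mean_cst _ (cube_gt0 d)).
Qed.

(** Differences commute with averaging, so [sum_incr_sqr] applies to each [diff k f], whose mean is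
    0. *)
Lemma sum_incr_energy f :
  \sum_(n < d) \sum_(k < d) mean (fun x => diff k (incr n f) x ^+ 2) =
  \sum_(k < d) mean (fun x => diff k f x ^+ 2).
Proof.
rewrite exchange_big; apply: eq_bigr => k _.
transitivity (\sum_(n < d) mean (fun x => incr n (diff k f) x ^+ 2)).
  by apply: eq_bigr => n _; apply: eq_mean => x; rewrite incr_diff.
by rewrite sum_incr_sqr /diff meanB mean_flip subrr expr0n subr0.
Qed.

Lemma mean_norm_incr n f :
  mean (fun x => `|incr n f x|) <= mean (fun x => `|diff n f x|) / 2.
Proof.
under eq_mean do rewrite incrE -avgs_diff normrM mulrC.
by rewrite meanZ mulrC gtr0_norm ?invr_gt0// ler_pM2r ?invr_gt0// mean_norm_avgs.
Qed.

Lemma mean_xlnx_avg k f w :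
  (forall x, 0 <= f x) -> (forall x, 0 <= w x) ->
  (forall x, (f x - f (flip k x)) ^+ 2 <= w x * (f x + f (flip k x))) ->
  mean (fun x => xlnx (f x)) - mean (fun x => xlnx (avg k f x)) <= mean w / 2.
Proof.
move=> f0 w0 fw.
rewrite -[X in X - _](mean_avg k) -meanB [leRHS]mulrC -meanZ.
apply: le_mean => x; rewrite /avg.
have := xlnx_two_point (f0 x) (f0 (flip k x)) (w0 x) (fw x); lra.
Qed.

(* [(f - g)^2 <= w (f + g)] is a convex condition on [(f, g, w)], hence it is
   preserved by averaging. *)
Lemma avgs_two_point n k f w :
  (forall x, 0 <= f x) -> (forall x, 0 <= w x) ->
  (forall x, (f x - f (flip k x)) ^+ 2 <= w x * (f x + f (flip k x))) ->
  forall x, (avgs n f x - avgs n f (flip k x)) ^+ 2 <=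
    avgs n w x * (avgs n f x + avgs n f (flip k x)).
Proof.
move=> f0 w0 fw; elim: n => // n IH x.
have af := avgs_ge0 n f0; have aw := avgs_ge0 n w0.
have := two_point_relD (addr_ge0 (af x) (af (flip k x))) (aw x)
  (addr_ge0 (af (flip n x)) (af (flip k (flip n x)))) (aw (flip n x))
  (IH x) (IH (flip n x)).
rewrite /= /avg -/(avgs n f) -/(avgs n w) (flipC n k); lra.
Qed.

(** The entropy of [f^2] telescopes along [avgs]: forgetting coordinate [k] lowers it by at most the
    energy of [f] in direction [k]. *)
Lemma log_sobolev f :
  mean (fun x => xlnx (f x ^+ 2)) - xlnx (mean (fun x => f x ^+ 2)) <=
  \sum_(k < d) mean (fun x => diff k f x ^+ 2).
Proof.
pose g x := f x ^+ 2.
pose e n := - mean (fun x => xlnx (avgs n g x)).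
have -> : mean (fun x => xlnx (f x ^+ 2)) - xlnx (mean g) = e d - e 0%N.
  rewrite /e opprK [RHS]addrC; congr (_ - _).
  by under [RHS]eq_mean do rewrite avgs_full; rewrite (mean_cst _ (cube_gt0 d)).
rewrite -(@telescope_sumr _ 0 d e)// big_mkord; apply: ler_sum => k _.
rewrite /e opprK addrC.
(* With the factor 2, the two sides of the two-point condition for [g] differ by
   [(f x - f (flip k x))^4]. *)
pose w x := 2 * diff k f x ^+ 2.
have w0 x : 0 <= w x by rewrite mulr_ge0 ?sqr_ge0.
have g0 x : 0 <= g x by exact: sqr_ge0.
have gw x : (g x - g (flip k x)) ^+ 2 <= w x * (g x + g (flip k x)).
  rewrite -subr_ge0 (_ : _ - _ = ((f x - f (flip k x)) ^+ 2) ^+ 2) ?sqr_ge0//.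
  by rewrite /g /w /diff; ring.
apply: le_trans (mean_xlnx_avg (avgs_ge0 k g0) (avgs_ge0 k w0) (avgs_two_point k g0 w0 gw)) _.
by rewrite mean_avgs /w meanZ mulrAC divff ?mul1r.
Qed.

(** With [t = |f x|], the bound [ln (s / t) <= s / t - 1] gives
    [t^2 ln t^2 >= 2 t^2 ln s + 2 t^2 - 2 s t]; after averaging, the best [s] is [p / q]. *)
Lemma entropy_ge f q p : 0 < q -> mean (fun x => `|f x|) <= q ->
  mean (fun x => f x ^+ 2) = p ->
  p * ln (p / q ^+ 2) <= mean (fun x => xlnx (f x ^+ 2)) - xlnx p.
Proof.
move=> q0 fq pE.
have p0 : 0 <= p by rewrite -pE; apply: mean_ge0 => x; exact: sqr_ge0.
have tangent s : 0 < s ->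
    2 * p * ln s + 2 * p - 2 * s * q <= mean (fun x => xlnx (f x ^+ 2)).
  move=> s0.
  apply: (@le_trans _ _ ((2 * ln s + 2) * p - 2 * s * mean (fun x => `|f x|))).
    have := ler_wpM2l (ltW s0) fq; lra.
  rewrite -pE -!meanZ -meanB; apply: le_mean => x; rewrite /xlnx.
  have [->|fx] := eqVneq (f x) 0; first by rewrite normr0 expr0n /= !(mulr0, mul0r) subr0.
  have a0 : 0 < `|f x| by rewrite normr_gt0.
  rewrite -(real_normK (num_real (f x))) lnXn//.
  have := @le_ln1Dx _ (s / `|f x| - 1); rewrite addrCA subrr addr0 ln_div ?posrE//.
  have sa : 0 < s / `|f x| by rewrite divr_gt0.
  move=> /(_ ltac:(lra)) h.
  have := ler_wpM2l (sqr_ge0 `|f x|) h.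
  have -> : `|f x| ^+ 2 * (s / `|f x| - 1) = `|f x| * s - `|f x| ^+ 2.
    by field; rewrite gt_eqF.
  rewrite mulr2n; lra.
move: p0; rewrite le_eqVlt => /predU1P[p0|p0].
  rewrite -p0 mul0r /xlnx mul0r subr0; move: tangent; rewrite -p0 => tangent.
  rewrite leNgt; apply/negP => /= m0.
  (* Here [p = 0]; if the mean [m] is negative, this [s] turns the tangent bound into
     [m / 2 <= m]. *)
  have := tangent (- mean (fun x => xlnx (f x ^+ 2)) / (4 * q))
    ltac:(by rewrite divr_gt0 ?mulr_gt0 ?oppr_gt0).
  rewrite mulr0 !mul0r add0r sub0r.
  set m := mean _ in m0 *.
  have -> : - (2 * (- m / (4 * q)) * q) = m / 2 by field; rewrite gt_eqF.
  rewrite /xlnx in m0 *; lra.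
have := tangent (p / q) (divr_gt0 p0 q0).
rewrite /xlnx !ln_div ?posrE ?exprn_gt0// lnXn// mulr2n.
have -> : 2 * (p / q) * q = 2 * p by field; rewrite gt_eqF.
lra.
Qed.

End Averaging.

(** * Boolean functions with equal influences *)

Section EqualInfluences.
Variables (R : realType) (d : nat) (b : cube d -> bool) (a : R).
Let f x : R := (b x)%:R.
Hypothesis infl : forall k, (k < d)%N -> mean (fun x => diff k f x ^+ 2) = a.

Let v := mean (fun x => f x ^+ 2) - mean f ^+ 2.
Let p n := mean (fun x => incr n f x ^+ 2).

Let p_ge0 n : 0 <= p n.
Proof. by apply: mean_ge0 => x; exact: sqr_ge0. Qed.

Let pE : \sum_(n < d) p n = v.
Proof. exact: sum_incr_sqr. Qed.

(** Differences of 0/1 values are -1, 0 or 1, where absolute value and square agree. *)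
Let mean_norm_diff n : (n < d)%N -> mean (fun x => `|diff n f x|) = a.
Proof.
move=> nd; rewrite -(infl nd); apply: eq_mean => x; rewrite /diff /f.
by case: (b x); case: (b _);
  rewrite /= ?(subrr, subr0, sub0r, normrN, sqrrN, normr0, normr1, expr0n, expr1n).
Qed.

Let v_le1 : v <= 1.
Proof.
have h : mean (fun x => f x ^+ 2) <= 1.
  rewrite -[leRHS](@mean_cst R _ 1 (cube_gt0 d)); apply: le_mean => x.
  by rewrite /f; case: (b x); rewrite ?(expr0n, expr1n) ?ler01.
by rewrite /v lerBlDr ler_wpDr ?sqr_ge0.
Qed.

(** The square of [incr n f] has entropy at least [p n ln (p n / q^2)] by [entropy_ge], and at most
    the energy of [incr n f] by [log_sobolev]; these energies add up to [d a]. A free [q] also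
    covers [a = 0], where [a / 2] is not positive. *)
Let v_ln q : 0 < q -> a <= 2 * q -> 0 < v -> v * ln (v / (d%:R * q ^+ 2)) <= d%:R * a.
Proof.
move=> q0 aq v0.
have d0 : 0 < d%:R :> R.
  by rewrite ltr0n lt0n; apply/eqP => d0; move: pE v0; rewrite d0 big_ord0 => <-; rewrite ltxx.
set r := v / _.
have r0 : 0 < r by rewrite divr_gt0// mulr_gt0// exprn_gt0.
(* The log-sum inequality, from the tangent bound [ln (y / r) >= 1 - r / y]. *)
have logsum n : p n * ln r + p n - r * q ^+ 2 <= p n * ln (p n / q ^+ 2).
  have := p_ge0 n; rewrite le_eqVlt => /predU1P[<-|pn].
    by rewrite !mul0r add0r sub0r oppr_le0 mulr_ge0 ?sqr_ge0 ?ltW.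
  set y := p n / _.
  have y0 : 0 < y by rewrite divr_gt0// exprn_gt0.
  have ry : 0 < r / y by rewrite divr_gt0.
  have := @le_ln1Dx _ (r / y - 1); rewrite addrCA subrr addr0 ln_div ?posrE//.
  move=> /(_ ltac:(lra)) h.
  have := ler_wpM2l (ltW pn) h.
  have -> : p n * (r / y - 1) = r * q ^+ 2 - p n.
    by rewrite /y; field; rewrite !gt_eqF.
  lra.
have ent (n : 'I_d) : p n * ln (p n / q ^+ 2) <=
    \sum_(k < d) mean (fun x => diff k (incr n f) x ^+ 2).
  apply: le_trans (log_sobolev _); apply: entropy_ge => //.
  by apply: le_trans (mean_norm_incr n f) _; rewrite mean_norm_diff//; lra.
have : \sum_(n < d) (p n * ln r + p n - r * q ^+ 2) <= d%:R * a.
  have -> : d%:R * a = \sum_(n < d) \sum_(k < d) mean (fun x => diff k (incr n f) x ^+ 2).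
    rewrite sum_incr_energy (eq_bigr (fun=> a)) ?sumr_const ?card_ord ?mulr_natl//.
    by move=> k _; exact: infl.
  by apply: ler_sum => n _; exact: le_trans (logsum n) (ent n).
rewrite sumrB big_split -mulr_suml /= pE sumr_const card_ord -[_ *+ d]mulr_natl.
have -> : d%:R * (r * q ^+ 2) = v by rewrite /r; field; rewrite !gt_eqF.
lra.
Qed.

Lemma equal_influences_ge : v * ln d%:R <= 3 * (d%:R * a).
Proof.
(* For [d = 0] the convention [ln 0 = 0] applies. *)
have [->|d0] := posnP d; first by rewrite ln0 ?mulr0 ?mul0r ?mulr0.
have a0 : 0 <= a by rewrite -(infl d0); apply: mean_ge0 => x; exact: sqr_ge0.
have v0 : 0 <= v by rewrite -pE; apply: sumr_ge0 => n _; exact: p_ge0.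
have L0 : 0 <= ln d%:R :> R by rewrite ln_ge0// ler1n.
have dp : 0 < d%:R :> R by rewrite ltr0n.
move: v0; rewrite le_eqVlt => /predU1P[v0|v0].
  by rewrite -v0 mul0r !mulr_ge0// ltW.
rewrite leNgt; apply/negP => lt.
move: a0; rewrite le_eqVlt => /predU1P[a0|a0].
  (* This [q] makes the argument of the logarithm [4 d / v > 1], against a right-hand side 0. *)
  have q0 : 0 < v / (2 * d%:R) by rewrite divr_gt0 ?mulr_gt0.
  have := v_ln q0 _ v0; rewrite -a0 mulr0 => /(_ ltac:(lra)).
  rewrite leNgt mulr_gt0//.
  have -> : v / (d%:R * (v / (2 * d%:R)) ^+ 2) = 4 * d%:R / v.
    by field; rewrite !gt_eqF.
  rewrite ln_gt0// ltr_pdivlMr// mul1r.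
  have : 1 <= d%:R :> R by rewrite ler1n.
  have := v_le1; lra.
(* [z] is the cube root of [d], and it exceeds [ln d / 3]. *)
set L := ln _ in L0 lt; set z := expR (L / 3).
have z3 : z ^+ 3 = d%:R.
  rewrite /z -expRM_natl; have -> : 3%:R * (L / 3) = L by field.
  by rewrite lnK.
have zL : L / 3 < z by have := expR_ge1Dx (L / 3); rewrite -/z; lra.
have z0 : 0 < z by exact: expR_gt0.
have := v_ln (_ : 0 < a / 2) _ v0.
have -> : v / (d%:R * (a / 2) ^+ 2) = 4 * v / (d%:R * a ^+ 2).
  by field; rewrite !gt_eqF.
set X := 4 * v / _.
have X0 : 0 < X by rewrite divr_gt0 ?mulr_gt0 ?exprn_gt0.
move=> /(_ ltac:(lra) ltac:(lra)) h.
have XL : ln X < L / 3 by rewrite -(ltr_pM2l v0); lra.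
have : X < z by rewrite -(lnK X0) ltr_expR.
rewrite /X ltr_pdivrMr; last by rewrite mulr_gt0 ?exprn_gt0.
set t := d%:R * a in lt h *.
have t0 : 0 < t by exact: mulr_gt0.
move=> X1.
have : 4 * v * z ^+ 3 < z * t ^+ 2.
  have := X1; rewrite -(ltr_pM2l dp) -z3 /t -z3.
  have -> : z ^+ 3 * (z * (z ^+ 3 * a ^+ 2)) = z * (z ^+ 3 * a) ^+ 2 by ring.
  by rewrite [X in X < _]mulrC.
have -> : 4 * v * z ^+ 3 = z * (4 * v * z ^+ 2) by ring.
rewrite ltr_pM2l// => X2.
(* The bounds on [t = d a] clash: [4 v z^2 < t^2 < v^2 z^2 <= v z^2], the last one by [v <= 1]. *)
have tv : t < v * z by apply: (@lt_trans _ _ (v * (L / 3))); [lra|rewrite ltr_pM2l].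
have : t ^+ 2 < (v * z) ^+ 2 by rewrite ltr_sqr ?nnegrE ?ltW// mulr_gt0.
have : (v * z) ^+ 2 <= v * z ^+ 2.
  by rewrite exprMn ler_pM2r ?exprn_gt0// expr2 ler_piMr// ltW.
have : 0 < v * z ^+ 2 by rewrite mulr_gt0 ?exprn_gt0.
lra.
Qed.

End EqualInfluences.

(** * From cuts to [L_1] distances *)

Section Cuts.
Variable R : realType.

(** [y - v] is the sum of the gaps between consecutive entries up to [y]; a pair holds a gap and its
    lower end. The bound on [c.2] makes the cuts of the tail vanish at the new head. *)
Lemma sub_head_cuts (v : R) (s : seq R) : path <=%R v s ->
  exists2 cs : seq (R * R), all (fun c => (0 <= c.1) && (v <= c.2)) cs &
    {in v :: s, forall y, y - v = \sum_(c <- cs) c.1 * (c.2 < y)%R%:R}.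
Proof.
elim: s v => [|u s IH] v /=.
  by exists [::] => // y; rewrite inE big_nil => /eqP->; rewrite subrr.
move=> /andP[vu us]; have [cs /allP cs0 csE] := IH u us.
exists ((u - v, v) :: cs).
  rewrite /= subr_ge0 vu lexx /=; apply/allP => c /cs0 /andP[-> /=].
  exact: le_trans.
move=> y; rewrite inE => /predU1P[->|yus].
  rewrite subrr big_cons ltxx mulr0 add0r big_seq big1// => c /cs0 /andP[_ uc].
  by rewrite ltNge (le_trans vu uc) mulr0.
rewrite big_cons -csE//= -[LHS](subrKA u) addrC; congr (_ + _).
have uy : u <= y.
  move: yus; rewrite inE => /predU1P[->//|ys].
  by move: us => /(order_path_min le_trans)/allP/(_ _ ys).
move: vu; rewrite le_eqVlt => /predU1P[->|vu].
  by rewrite subrr mul0r.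
by rewrite (lt_le_trans vu uy) mulr1.
Qed.

(** For [y <= x] the differences of all cuts have the same sign, so the absolute value passes
    through the sum. *)
Lemma dist_cuts (s : seq R) :
  exists2 cs : seq (R * R), all (fun c => 0 <= c.1) cs &
    {in s &, forall x y,
      `|x - y| = \sum_(c <- cs) c.1 * `|(c.2 < x)%R%:R - (c.2 < y)%R%:R|}.
Proof.
have [cs cs0 csE] : exists2 cs : seq (R * R), all (fun c => 0 <= c.1) cs &
    {in s &, forall x y,
      x - y = \sum_(c <- cs) c.1 * ((c.2 < x)%R%:R - (c.2 < y)%R%:R)}.
  have := sort_sorted (@le_total _ R) s.
  case E: (sort <=%R s) => [|v t] /=.
    by exists [::] => // x y; rewrite -(mem_sort <=%R s) E.
  move=> /sub_head_cuts[cs cs0 csE]; exists cs.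
    by apply: sub_all cs0 => c /andP[].
  move=> x y; rewrite -!(mem_sort <=%R s) E => xs ys.
  have -> : x - y = (x - v) - (y - v) by ring.
  rewrite csE// csE// -sumrB.
  by apply: eq_bigr => c _; rewrite mulrBr.
exists cs => // x y xs ys.
wlog yx : x y xs ys / y <= x => [h|].
  have [/h->//|/ltW/h xy] := leP y x.
  by rewrite distrC xy//; apply: eq_bigr => c _; rewrite distrC.
rewrite ger0_norm ?subr_ge0// csE//; apply: eq_bigr => c _; congr (_ * _).
have [cy|] := ltP c.2 y; first by rewrite (lt_le_trans cy yx) subrr normr0.
by rewrite subr0 normr_nat.
Qed.

Section Line.
Variables (I : finType) (J : Type) (p : I -> J) (w : I -> I -> R).

(* Every real-valued function on [I] is a sum of cuts, up to a constant. *)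
Lemma cuts_line_ge0 :
  (forall b : J -> bool, 0 <= \sum_x \sum_y w x y * `|(b (p x))%:R - (b (p y))%:R|) ->
  forall f : J -> R, 0 <= \sum_x \sum_y w x y * `|f (p x) - f (p y)|.
Proof.
move=> wb f; have [cs cs0 csE] := dist_cuts (codom (f \o p)).
have -> : \sum_x \sum_y w x y * `|f (p x) - f (p y)| = \sum_(c <- cs) c.1 *
    \sum_x \sum_y w x y * `|(c.2 < f (p x))%R%:R - (c.2 < f (p y))%R%:R|.
  under eq_bigr => x _.
    under eq_bigr => y _ do rewrite (csE _ _ (codom_f _ x) (codom_f _ y)) mulr_sumr.
    rewrite exchange_big; over.
  rewrite exchange_big; apply: eq_bigr => c _; rewrite mulr_sumr.
  apply: eq_bigr => x _; rewrite mulr_sumr.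
  by apply: eq_bigr => y _; rewrite mulrCA.
rewrite big_seq; apply: sumr_ge0 => c cc.
by rewrite mulr_ge0 ?(allP cs0)// (wb (fun x => (c.2 < f x)%R)).
Qed.

End Line.

Lemma L1_dist_integral (f g : L1_01 R) :
  (mdist f g)%:E = (\int[lebesgue01 R]_t (`|f t - g t|)%:E)%E.
Proof. by have := L1_distE f g; rewrite Lnorm1; apply: etrans. Qed.

Lemma L1_dist_integrable (f g : L1_01 R) :
  (lebesgue01 R).-integrable setT (fun t => (`|f t - g t|)%:E).
Proof.
have meas (h : L1_01 R) : measurable_fun [set: measurableTypeR R] (h : _ -> R).
  exact: (measurable_funPT (generic_quotient.repr (h : aeEqMfun _ _))).
apply/integrableP; split.
  apply/measurable_EFinP/measurableT_comp => //.
  exact: measurable_funB (meas f) (meas g).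
rewrite (eq_integral (fun t => (`|f t - g t|)%:E)) => [|t _]; last by rewrite /= normr_id.
by rewrite -L1_dist_integral ltry.
Qed.

(** The [L_1] distance integrates the distances of the values at [t], so the inequality on the line
    is integrated over [t]. With [p] the projection onto the orbits, only cuts of the quotient have
    to be tested. *)
Lemma cuts_L1_ge0 (I : finType) (J : Type) (p : I -> J) (w : I -> I -> R) :
  (forall b : J -> bool, 0 <= \sum_x \sum_y w x y * `|(b (p x))%:R - (b (p y))%:R|) ->
  forall F : J -> L1_01 R, 0 <= \sum_x \sum_y w x y * mdist (F (p x)) (F (p y)).
Proof.
move=> /cuts_line_ge0 line F.
pose h (u : I * I) t : \bar R :=
  ((w u.1 u.2)%:E * (`|F (p u.1) t - F (p u.2) t|)%:E)%E.
(* [w] may take both signs, so exchanging sum and integral rests on integrability. *)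
have hint u : (lebesgue01 R).-integrable setT (h u).
  exact/integrableZl/L1_dist_integrable.
rewrite pair_bigA -lee_fin -sumEFin.
have -> : (\sum_u (w u.1 u.2 * mdist (F (p u.1)) (F (p u.2)))%:E =
   \int[lebesgue01 R]_t (\sum_u h u t))%E.
  rewrite integral_sum//; apply: eq_bigr => u _.
  by rewrite integralZl ?EFinM ?L1_dist_integral//; exact: L1_dist_integrable.
apply: integral_ge0 => t _.
under eq_bigr do rewrite /h -EFinM.
by rewrite sumEFin lee_fin; have := line (fun x => F x t); rewrite pair_bigA.
Qed.

End Cuts.

(** * The Laplace transform of the Hamming distance *)

Section Counting.
Variables (R : realType) (d : nat).

Lemma sum_cube_prod (h : 'I_d -> 'F_2 -> R) :
  \sum_(x : cube d) \prod_j h j (x 0 j) = \prod_j \sum_c h j c.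
Proof.
rewrite bigA_distr_bigA (reindex (fun x : cube d => [ffun j => x 0 j])) /=.
  by apply: eq_bigr => x _; apply: eq_bigr => j _; rewrite ffunE.
exists (fun g : {ffun 'I_d -> 'F_2} => \row_j g j : cube d) => [x _|g _].
  by apply/rowP => j; rewrite mxE ffunE.
by apply/ffunP => j; rewrite ffunE mxE.
Qed.

(** The coordinates of a uniform [x] are independent, and each differs from that of [y] with
    probability 1/2. *)
Lemma mean_expn_hamming (l : R) (y : cube d) :
  mean (fun x => l ^+ hamming x y) = ((1 + l) / 2) ^+ d.
Proof.
have hE x : l ^+ hamming x y = \prod_j (if x 0 j != y 0 j then l else 1).
  by rewrite /hamming -prodr_const big_mkcond.
rewrite /mean (eq_bigr _ (fun x _ => hE x)).
rewrite (sum_cube_prod (fun j c => if c != y 0 j then l else 1)).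
have -> : #|{: cube d}| = (2 ^ d)%N by rewrite card_mx card_Fp// mul1n.
rewrite (eq_bigr (fun=> 1 + l)) => [|j _].
  by rewrite prodr_const card_ord natrX expr_div_n mulrC.
rewrite (bigD1 (y 0 j))//= eqxx; congr (_ + _).
rewrite (eq_bigr (fun=> l)) => [|c ->//].
rewrite sumr_const -[RHS]mulr1n; congr (_ *+ _).
by have := cardC1 (y 0 j); rewrite card_Fp.
Qed.

End Counting.

(** * Distances and invariant functions on the quotient *)

Section Orbits.
Variables (R : realType) (d : nat) (G : {group 'S_d}).
Implicit Types x y : cube d.

Lemma cube_perm_inj (s : 'S_d) : injective (@cube_perm d ^~ s).
Proof. exact: (act_inj (cube_action d) s). Qed.

Lemma flip_cube_perm (s : 'S_d) (k : 'I_d) x :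
  flip (s k) (cube_perm x s) = cube_perm (flip k x) s.
Proof.
apply/rowP => j; rewrite flipE [RHS]mxE flipE mxE; congr (_ + (_ : bool)%:R).
have -> : (j == s k :> nat) = (j == s k) by [].
by rewrite -(inj_eq (@perm_inj _ s^-1%g)) permK.
Qed.

Lemma hamming_flip k x : (hamming x (flip k x) <= 1)%N.
Proof.
rewrite /hamming; have [kd|dk] := ltnP k d.
  apply: (@leq_trans #|pred1 (Ordinal kd)|); last by rewrite card1.
  apply/subset_leq_card/fintype.subsetP => j.
  rewrite !inE flipE; apply: contraR => jk.
  have -> : (j == k :> nat) = false by exact/negbTE.
  by rewrite addr0.
rewrite eq_card0// => j; rewrite !inE flipE.
by rewrite (ltn_eqF (leq_trans (ltn_ord j) dk)) addr0 eqxx.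
Qed.

Fact orbit_of_subproof x :
  orbit (cube_action d) G x \in [set orbit (cube_action d) G x | x : cube d]%SET.
Proof. exact: imset_f. Qed.

Definition orbit_of x : orbit_space R G :=
  exist (fun A => is_true (A \in [set orbit (cube_action d) G x | x : cube d]%SET))
    _ (orbit_of_subproof x).

Lemma mem_orbit_of x : x \in val (orbit_of x).
Proof. exact: orbit_refl. Qed.

Lemma orbit_of_perm x (s : 'S_d) : s \in G -> orbit_of (cube_perm x s) = orbit_of x.
Proof. by move=> sG; apply: val_inj; apply: orbit_act. Qed.

Lemma dist_orbit_of_le x y : mdist (orbit_of x) (orbit_of y) <= (hamming x y)%:R.
Proof. exact: orbit_dist_le (mem_orbit_of x) (mem_orbit_of y). Qed.

(** Moving both nearest representatives by one element of [G] brings the first back to [x]. *)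
Lemma dist_orbit_ofE x y : exists2 s, s \in G &
  mdist (orbit_of x) (orbit_of y) = (hamming x (cube_perm y s))%:R.
Proof.
have [u [v [/orbitP[s sG <-] /orbitP[t tG <-] e]]] := orbit_distP (orbit_of x) (orbit_of y).
exists (t * s^-1)%g; first by rewrite groupM ?groupV.
apply: etrans e _; rewrite -(hamming_perm s^-1%g); congr (hamming _ _)%:R.
  by rewrite -cube_permM mulgV cube_perm1.
by rewrite cube_permM.
Qed.

(** The term of the minimizing [s] is at most the sum over [G], and each [s] permutes the cube, so
    all terms have the same mean. *)
Lemma mean_expR_dist_le (t : R) :
  mean (fun x => mean (fun y => expR (- t * mdist (orbit_of x) (orbit_of y)))) <=
  #|G|%:R * ((1 + expR (- t)) / 2) ^+ d.
Proof.
set l := expR (- t).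
have -> : #|G|%:R * ((1 + l) / 2) ^+ d =
  mean (fun x : cube d => mean (fun y : cube d =>
    \sum_(s in G) l ^+ hamming x (cube_perm y s))).
  rewrite -[LHS](@mean_cst R _ _ (cube_gt0 d)); apply: eq_mean => x.
  rewrite /mean exchange_big mulr_sumr (eq_bigr (fun=> ((1 + l) / 2) ^+ d)).
    by rewrite sumr_const mulr_natl.
  move=> s _; rewrite -(mean_expn_hamming l x).
  rewrite -[RHS](mean_inj _ (@cube_perm_inj s)); congr (_ * _).
  by apply: eq_bigr => y _; rewrite hammingC.
apply: le_mean => x; apply: le_mean => y.
have [s sG ->] := dist_orbit_ofE x y.
rewrite (bigD1 s)//= -expRM_natr ler_wpDr// sumr_ge0// => i _.
by rewrite exprn_ge0// expR_ge0.
Qed.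

Hypothesis trG : [transitive G, on [set: 'I_d] | 'P].

(** Some [s] in [G] takes [k] to [l], and permuting by [s] carries flips of [k] to flips of [l]. *)
Lemma invariant_influences (f : cube d -> R) :
  (forall x s, s \in G -> f (cube_perm x s) = f x) ->
  forall k l, (k < d)%N -> (l < d)%N ->
  mean (fun x => diff k f x ^+ 2) = mean (fun x => diff l f x ^+ 2).
Proof.
move=> fG k l kd ld.
have [s sG sl] : exists2 s, s \in G & Ordinal ld = s (Ordinal kd).
  exact: (atransP2 trG).
rewrite -[RHS](mean_inj _ (@cube_perm_inj s)); apply: eq_mean => x.
have := flip_cube_perm s (Ordinal kd) x; rewrite -sl /= /diff fG// => ->.
by rewrite fG.
Qed.

(** For 0/1 values distances are squares, so the mean over pairs is twice the variance: this turns
    the constant 3 into 6. *)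
Lemma equal_influences_cut (b : cube d -> bool) :
  (forall x s, s \in G -> b (cube_perm x s) = b x) ->
  ln d%:R * mean (fun x => mean (fun y => `|(b x)%:R - (b y)%:R|)) <=
  6 * \sum_(k < d) mean (fun x => `|(b x)%:R - (b (flip k x))%:R|) :> R.
Proof.
move=> bG; have [d0|d0] := posnP d.
  have -> : ln d%:R = 0 :> R by rewrite d0 ln0.
  by rewrite mul0r mulr_ge0// sumr_ge0// => k _; exact: mean_ge0.
pose f x : R := (b x)%:R.
have fG x s : s \in G -> f (cube_perm x s) = f x by move=> sG; rewrite /f bG.
have sqr x y : `|f x - f y| = (f x - f y) ^+ 2.
  by rewrite /f; case: (b x); case: (b y);
    rewrite /= ?(subrr, subr0, sub0r, normrN, sqrrN, normr0, normr1, expr0n, expr1n).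
have infl k (kd : (k < d)%N) := invariant_influences fG kd d0.
have := equal_influences_ge infl.
have -> : d%:R * mean (fun x => diff 0 f x ^+ 2) =
    \sum_(k < d) mean (fun x => `|f x - f (flip k x)|).
  rewrite [RHS](eq_bigr (fun=> mean (fun x => diff 0 f x ^+ 2))) => [|k _].
    by rewrite sumr_const card_ord mulr_natl.
  by rewrite -(infl k)//; apply: eq_mean => x; rewrite sqr.
have -> : mean (fun x => mean (fun y => `|f x - f y|)) =
    2 * (mean (fun x => f x ^+ 2) - mean f ^+ 2).
  rewrite -(mean_variance _ (cube_gt0 d)).
  by apply: eq_mean => x; apply: eq_mean => y; exact: sqr.
rewrite -/f; lra.
Qed.

Lemma L1_orbit_inequality (F : orbit_space R G -> L1_01 R) :
  ln d%:R * mean (fun x => mean (fun y => mdist (F (orbit_of x)) (F (orbit_of y)))) <=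
  6 * \sum_(k < d) mean (fun x => mdist (F (orbit_of x)) (F (orbit_of (flip k x)))).
Proof.
pose N : R := #|{: cube d}|%:R.
(* Pairing [w] with a kernel [D] gives the right-hand side minus the left-hand side, with [D] as the
   distance. *)
pose w x y : R := 6 * \sum_(k < d) (N^-1 * (y == flip k x)%:R) - ln d%:R * (N^-1 * N^-1).
have wE (D : cube d -> cube d -> R) : \sum_x \sum_y w x y * D x y =
    6 * \sum_(k < d) mean (fun x => D x (flip k x)) -
    ln d%:R * mean (fun x => mean (D x)).
  have e x : \sum_y w x y * D x y =
      6 * \sum_(k < d) (N^-1 * D x (flip k x)) - ln d%:R * (N^-1 * mean (D x)).
    rewrite /w; under eq_bigr => y _ do rewrite mulrBl -mulrA mulr_suml.
    rewrite sumrB -mulr_sumr exchange_big; congr (_ * _ - _).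
      apply: eq_bigr => k _; rewrite (bigD1 (flip k x))//= eqxx mulr1 big1 ?addr0//.
      by move=> y /negPf->; rewrite mulr0 mul0r.
    by rewrite /mean !mulr_sumr; apply: eq_bigr => y _; rewrite !mulrA.
  rewrite (eq_bigr _ (fun x _ => e x)) sumrB -!mulr_sumr exchange_big /mean.
  congr (_ * _ - _ * _); last by rewrite mulr_sumr.
  by rewrite mulr_sumr; apply: eq_bigr => k _; rewrite mulr_sumr.
rewrite -subr_ge0 -wE; apply: cuts_L1_ge0 => b; rewrite wE subr_ge0.
apply: (@equal_influences_cut (b \o orbit_of)) => x s sG.
by rewrite /= orbit_of_perm.
Qed.

End Orbits.

(** * Lower bound for the mean quotient distance *)

Lemma ln2_bounds (R : realType) : 1 / 2 <= ln (2 : R) <= 1.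
Proof.
have h1 := @le_ln1Dx R 1; have h2 := @le_ln1Dx R (- (1 / 2)).
have e : 1 + - (1 / 2) = 2^-1 :> R by field.
move: h1 h2; rewrite e lnV ?posrE// => /(_ ltac:(lra)) h1 /(_ ltac:(lra)) h2.
by apply/andP; split; [lra|rewrite [leLHS](_ : _ = ln (1 + 1 : R))].
Qed.

Lemma mean_orbit_dist_ge (R : realType) (d : nat) (G : {group 'S_d}) (eps : R) :
  0 < eps -> eps < 1 -> #|G|%:R < 2 `^ (eps * d%:R) -> (0 < d)%N ->
  d%:R * ((1 - eps) / (1 - ln (1 - eps))) <=
  8 * mean (fun x => mean (fun y => mdist (orbit_of R G x) (orbit_of R G y))).
Proof.
move=> eps0 eps1 cardG d_gt0; set M := mean _.
have /andP[ln2l ln2u] := ln2_bounds R.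
have e0 : 0 < 1 - eps by lra.
have d0 : 0 < d%:R :> R by rewrite ltr0n.
(* The parameter of the Laplace transform: [expR (- t) = (1 - eps) / 4]. *)
pose t := 2 * ln 2 - ln (1 - eps).
have lE : expR (- t) = (1 - eps) / 4.
  rewrite /t opprB expRD expRN lnK ?posrE//.
  by rewrite expRM_natl lnK ?posrE//; congr (_ / _); ring.
have M_ge : expR (- t * M) <= #|G|%:R * ((1 + expR (- t)) / 2) ^+ d.
  apply: le_trans (mean_expR_dist_le G t).
  rewrite /M -meanZ.
  apply: le_trans (mean_Jensen_expR _ (cube_gt0 d)) _; apply: le_mean => x.
  by rewrite -meanZ; exact: mean_Jensen_expR (cube_gt0 d).
have q0 : 0 < (1 + expR (- t)) / 2 by rewrite divr_gt0// addr_gt0 ?expR_gt0.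
have : expR (- t * M) < 2 `^ (eps * d%:R) * ((1 + expR (- t)) / 2) ^+ d.
  by apply: le_lt_trans M_ge _; rewrite ltr_pM2r ?exprn_gt0.
rewrite -ltr_ln ?posrE ?expR_gt0 ?mulr_gt0 ?powR_gt0 ?exprn_gt0//.
rewrite expRK lnM ?posrE ?powR_gt0 ?exprn_gt0// ln_powR lnXn// ln_div ?posrE ?addr_gt0 ?expR_gt0//.
rewrite -[_ *+ d]mulr_natl => MG.
have := @le_ln1Dx _ (expR (- t)); move=> /(_ ltac:(by rewrite (lt_trans _ (expR_gt0 _)))) hl.
(* Taking logarithms gave [t M > d ((1 - eps) ln 2 - ln (1 + expR (- t)))]; now use [ln 2 >= 1 / 2]
   and [ln (1 + expR (- t)) <= (1 - eps) / 4]. *)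
have tM : d%:R * ((1 - eps) / 4) <= t * M.
  have : d%:R * (ln (1 + expR (- t)) - ln 2) <= d%:R * ((1 - eps) / 4 - ln 2).
    by rewrite ler_pM2l//; lra.
  have : d%:R * ((1 - eps) / 2) <= d%:R * ((1 - eps) * ln 2).
    by rewrite ler_pM2l//; nra.
  lra.
have lneps : ln (1 - eps) <= - eps by apply: le_ln1Dx; lra.
have M0 : 0 <= M by do 2!apply: mean_ge0 => ?; exact: mdist_ge0.
rewrite mulrA ler_pdivrMr; last by lra.
(* [t <= 2 (1 - ln (1 - eps))], as [ln 2 <= 1] and [ln (1 - eps) <= 0]. *)
have : t * M <= 2 * (1 - ln (1 - eps)) * M by apply: ler_wpM2r => //; rewrite /t; lra.
lra.
Qed.

(** * Lipschitz norms and distortion *)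

Section LipNorm.
Variables (R : realType) (S T : Type) (dS : S -> S -> R) (dT : T -> T -> R) (f : S -> T).

Lemma lip_norm_ge x y : x <> y -> ((dT (f x) (f y) / dS x y)%:E <= lip_norm dS dT f)%E.
Proof.
by move=> xy; rewrite /lip_norm le_max; apply/orP; right; apply: ereal_sup_ubound; exists (x, y).
Qed.

End LipNorm.

Section Distortion.
Variables (R : realType) (X Y : metricType R) (f : X -> Y).

(* Two distinct points make both Lipschitz norms positive: an infinite norm is
   then not absorbed by a zero one, as [0 * +oo = 0]. *)
Lemma distortion_ge (c : R) (x0 y0 : X) : x0 <> y0 ->
  (forall a b : R, 0 <= a -> 0 < b -> injective f ->
    (forall x y, mdist (f x) (f y) <= a * mdist x y) ->
    (forall x y, mdist x y <= b * mdist (f x) (f y)) -> c <= a * b) ->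
  (c%:E <= distortion f)%E.
Proof.
move=> xy0 H; rewrite /distortion; case: asboolP => [fI|_]; last exact: leey.
have mpos (Z : metricType R) (x y : Z) : x <> y -> 0 < mdist x y.
  by move=> xy; rewrite mdist_gt0; exact/eqP.
pose emb x : range f := exist _ (f x) (mem_set (imageT f x)).
have embK x : range_inv (emb x) = x.
  by apply: fI; rewrite /range_inv; case: cid.
have emb_inj x y : x <> y -> emb x <> emb y.
  by move=> xy /(congr1 (@range_inv _ _ f)); rewrite !embK.
have f_inj x y : x <> y -> f x <> f y by move=> xy /fI.
set A := lip_norm _ _ f; set B := lip_norm _ _ _.
have A_ge x y (xy : x <> y) : ((mdist (f x) (f y) / mdist x y)%:E <= A)%E by exact: lip_norm_ge.
have B_ge x y (xy : x <> y) : ((mdist x y / mdist (f x) (f y))%:E <= B)%E.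
  by have := lip_norm_ge (fun u v : range f => mdist (val u) (val v)) (@mdist R X)
    (@range_inv _ _ f) (emb_inj _ _ xy); rewrite !embK.
have A0 : (0 < A)%E.
  by apply: lt_le_trans (A_ge _ _ xy0); rewrite lte_fin divr_gt0 ?mpos//; exact: f_inj.
have B0 : (0 < B)%E.
  by apply: lt_le_trans (B_ge _ _ xy0); rewrite lte_fin divr_gt0 ?mpos//; exact: f_inj.
move: A B A0 B0 A_ge B_ge => [a| |] [b| |] //= A0 B0 A_ge B_ge;
  rewrite ?(gt0_muley, gt0_mulye, leey)//.
rewrite lte_fin in A0; rewrite lte_fin in B0.
rewrite -EFinM lee_fin; apply: H => //; first exact: ltW.
  move=> x y; have [->|/eqP xy] := eqVneq x y; first by rewrite !mdistxx mulr0.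
  by have := A_ge x y xy; rewrite lee_fin ler_pdivrMr ?mpos.
move=> x y; have [->|/eqP xy] := eqVneq x y; first by rewrite !mdistxx mulr0.
by have := B_ge x y xy; rewrite lee_fin ler_pdivrMr ?mpos//; exact: f_inj.
Qed.

End Distortion.

(** * The Poincare inequality against the mean quotient distance *)

Theorem corollary3p9 (R : realType) :
  exists c : R, 0 < c /\
    forall (d : nat) (eps : R) (G : {group 'S_d}),
      (1 <= d)%N -> 0 < eps -> eps < 1 ->
      [transitive G, on [set: 'I_d] | 'P] ->
      #|G|%:R < 2 `^ (eps * d%:R) ->
      ((c * ((1 - eps) / (1 - ln (1 - eps))) * ln d%:R)%:E
         <= L1_distortion (orbit_space R G))%E.
Proof.
(* [48 = 6 * 8], with 6 from [L1_orbit_inequality] and 8 from [mean_orbit_dist_ge]. *)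
exists (1 / 48); split; first by lra.
move=> d eps G d0 eps0 eps1 trG cardG.
have M_ge := mean_orbit_dist_ge eps0 eps1 cardG d0.
set M := mean _ in M_ge; set K := (1 - eps) / _ in M_ge *.
have e0 : 0 < 1 - eps by lra.
have lneps : ln (1 - eps) <= - eps by apply: le_ln1Dx; lra.
have K0 : 0 < K by rewrite divr_gt0//; lra.
have dR : 0 < d%:R :> R by rewrite ltr0n.
have L0 : 0 <= ln d%:R :> R by rewrite ln_ge0// ler1n.
(* [distortion_ge] asks for two distinct points; if all orbits coincided, [M] would be 0, against
   [M_ge]. *)
have [p [q pq]] : exists p q : orbit_space R G, p <> q.
  apply: contrapT => np; have eqX (x y : orbit_space R G) : x = y.
    by apply: contrapT => xy; apply: np; exists x, y.
  have M0 : M = 0.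
    rewrite /M; under eq_mean => x.
      by under eq_mean => y do rewrite (eqX (orbit_of R G x) (orbit_of R G y)) mdistxx; over.
    by rewrite !mean_cst ?cube_gt0.
  by have := mulr_gt0 dR K0; rewrite M0 in M_ge; lra.
apply: le_ereal_inf_tmp => _ [F _ <-]; apply: (distortion_ge pq) => a b a0 b0 _ Fa Fb.
have := L1_orbit_inequality trG F.
set SL := mean _ => h.
have MS : M <= b * SL.
  rewrite /M /SL -meanZ; apply: le_mean => x; rewrite -meanZ; apply: le_mean => y.
  exact: Fb.
(* A flip moves a point by at most 1, so each of the [d] means is at most [a]. *)
have SR : \sum_(k < d)
    mean (fun x => mdist (F (orbit_of R G x)) (F (orbit_of R G (flip k x)))) <= d%:R * a.
  rewrite mulr_natl -[X in _ *+ X]card_ord -sumr_const; apply: ler_sum => k _.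
  rewrite -[leRHS](@mean_cst R _ _ (cube_gt0 d)); apply: le_mean => x.
  apply: le_trans (Fa _ _) _; rewrite -[leRHS]mulr1 ler_wpM2l//.
  apply: le_trans (dist_orbit_of_le _ _ _ _) _.
  by rewrite -[1]/(1%:R) ler_nat hamming_flip.
have h1 : ln d%:R * M <= ln d%:R * (b * SL) by exact: ler_wpM2l.
have h2 : b * (ln d%:R * SL) <= b * (6 * (d%:R * a)) by rewrite ler_pM2l//; lra.
have h3 : ln d%:R * (d%:R * K) <= ln d%:R * (8 * M) by exact: ler_wpM2l.
have : d%:R * (ln d%:R * K) <= d%:R * (48 * (a * b)) by lra.
rewrite ler_pM2l//; lra.
Qed.
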